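(* Let $(X,d)$ be a compact metric space with at least three points, and suppose that $\dim_1(X) = m < +\infty$. Then $(X,d)$ is homeomorphic to a compact subset of $\mathbb{R}^m$.
   Context: A subset $S$ of a metric space $(X,d)$ is a ($1$-)metric generator for $X$ if for any two distinct points $u,v\in X$ there is $w\in S$ with $d(u,w)\neq d(v,w)$. $\dim_1(X)$ is the infimum of $|S|$ over all $1$-metric generators $S$ for $X$, where $|S|$ is the number of elements if $S$ is finite and $|S|=+\infty$ if $S$ is infinite. *)

(* Defs.v *)
From HB Require Import structures.
From mathcomp Require Import all_boot all_order all_algebra.
From mathcomp Require Import all_classical all_reals all_analysis.

Set Implicit Arguments.
Unset Strict Implicit.
Unset Printing Implicit Defensive.

Import Order.TTheory GRing.Theory Num.Theory.
Import numFieldNormedType.Exports.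

Local Open Scope classical_set_scope.
Local Open Scope ring_scope.

Definition metric_generator (R : realType) (X : metricType R) (S : set X) : Prop :=
  forall u v : X, u <> v -> exists2 w, S w & mdist u w <> mdist v w.

(* [counting S] is the number of elements of [S] when [S] is finite and [+oo]
   otherwise. *)
Definition dim1 (R : realType) (X : metricType R) : \bar R :=
  ereal_inf [set counting S | S in @metric_generator R X].

Definition homeomorphic (T U : topologicalType) : Prop :=
  exists (f : T -> U) (g : U -> T),
    [/\ cancel f g, cancel g f, continuous f & continuous g].

(* Main.v *)
(* Distances to a generator with [m] elements give an injective continuous map
   to [R^m], which is an embedding since its source is compact and its target is
   Hausdorff. *)

Require Import Defs.
From HB Require Import structures.
From mathcomp Require Import all_boot all_order all_algebra finmap.
From mathcomp Require Import all_classical all_reals all_analysis.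

Import Order.TTheory GRing.Theory Num.Theory.
Import numFieldNormedType.Exports.

Local Open Scope classical_set_scope.
Local Open Scope ring_scope.

(** Send a point to the row of its distances to the [m] elements of a generator. Injectivity of this
    map is exactly the generator property, and continuity holds coordinatewise; [compact_embedding]
    then makes it a homeomorphism onto its range. A generator of size exactly [m] exists because a
    finite infimum of cardinalities is attained ([dim1_attained]). *)

Lemma continuous_mx (m n : nat) (T U : topologicalType)
    (f : T -> 'M[U]_(m, n)) :
  (forall i j, continuous (fun x => f x i j)) -> continuous f.
Proof.
move=> cf x A [P xP PA].
(* [P] is a box of entrywise neighbourhoods inside [A]; only finitely many entries constrain [y]. *)
suff : \forall y \near x, forall i j, P i j (f y i j).
  by apply: filterS => y; exact: PA.
apply: filter_forall => i; apply: filter_forall => j.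
exact: (cf i j x _ (xP i j)).
Qed.

(** By the triangle inequality, the distance to [w] is 1-Lipschitz. *)
Lemma mdist_continuousl (R : realType) (X : metricType R) (w : X) :
  continuous (fun x : X => mdist x w : R).
Proof.
move=> x; apply/cvgrPdist_lt => e e0.
have : \forall y \near x, ball x e y by exact: nbhsx_ballx.
apply: filterS => y; rewrite ballEmdist/= => xye.
apply: le_lt_trans xye; rewrite ler_norml; apply/andP; split.
  by rewrite lerBrDl addrC -lerBrDl opprK addrC (metric_sym x) metric_triangle.
by rewrite lerBlDr metric_triangle.
Qed.

(** A closed set in a compact space has a compact image, which is closed in a Hausdorff space; so
    [f] is a closed map and its inverse is continuous. *)
Lemma compact_embedding (X Y : topologicalType) (f : X -> Y) :
  compact [set: X] -> hausdorff_space Y -> continuous f -> injective f ->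
  compact (range f) /\ homeomorphic X (set_type (range f)).
Proof.
move=> cX hY cf fI.
have compact_image A : closed A -> compact (f @` A).
  move=> clA; apply: continuous_compact; first exact: continuous_subspaceT.
  exact: (subclosed_compact clA cX).
split; first by apply: compact_image; exact: closedT.
have fK x : f x \in range f by rewrite inE; exists x.
pose F x : set_type (range f) := exist _ (f x) (fK x).
have ex_inv (y : set_type (range f)) : exists x, f x = set_val y.
  by have /set_mem[x _ fx] := valP y; exists x.
have [g gE] := choice ex_inv.
exists F, g; split.
- by move=> x; apply: fI; rewrite gE.
- by move=> y; apply: val_inj; rewrite /= gE.
- exact: continuous_comp_initial.
- apply/continuous_closedP => A clA.
  have -> : g @^-1` A = set_val @^-1` (f @` A).
    apply/seteqP; split => [y Ay|y [x Ax fxy]] /=.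
      by exists (g y).
    by have -> : g y = x by apply: fI; rewrite gE.
  have /continuous_closedP : continuous (@set_val Y (range f)).
    exact: initial_continuous.
  by apply; exact: compact_closed hY (compact_image _ clA).
Qed.

Lemma dim1_attained (R : realType) (X : metricType R) (m : nat) :
  dim1 X = (m%:R)%:E ->
  exists S : set X, [/\ metric_generator S, finite_set S & #|` fset_set S| = m].
Proof.
move=> dimX.
(* Sizes are integers or infinite: a generator of size below [m.+1] has at most [m] elements, and at
   least [m] by the infimum. *)
have : (dim1 X < (m.+1%:R)%:E)%E by rewrite dimX lte_fin ltr_nat.
move=> /ereal_inf_lt[_ [S genS <-]].
have : (dim1 X <= counting S)%E by apply: ereal_inf_lbound; exists S.
rewrite dimX /counting; case: ifPn => [/asboolP finS|_];
  last by move=> _; rewrite ltNge leey.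
rewrite lee_fin lte_fin ler_nat ltr_nat ltnS => mS Sm.
by exists S; split=> //; apply/eqP; rewrite eqn_leq Sm.
Qed.

(* [set_type K] carries the topology induced by ['rV[R]_m]. *)
Theorem theorem4p2 (R : realType) (X : metricType R) (m : nat)
    (cptX : compact [set: X])
    (X_ge3 : exists x y z : X, [/\ x <> y, x <> z & y <> z])
    (dimX : dim1 X = (m%:R)%:E) :
  exists K : set 'rV[R]_m, compact K /\ homeomorphic X (set_type K).
Proof.
have [S [genS finS cardS]] := dim1_attained _ _ _ dimX.
have [x0 _] := X_ge3.
(* The default [x0] is never returned, since by [cardS] every [i < m] is a valid index. *)
pose f (x : X) : 'rV[R]_m := \row_(i < m) mdist x (nth x0 (fset_set S) i).
exists (range f); apply: compact_embedding => //.
- apply: continuous_mx => i j.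
  under eq_fun do rewrite mxE.
  exact: mdist_continuousl.
- move=> u v fuv; apply: contrapT => /genS[w Sw]; apply.
  have wS : w \in fset_set S by rewrite in_fset_set// inE.
  (* The coordinate indexed by the separating point [w] tells [f u] from [f v]. *)
  have im : (index w (fset_set S) < m)%N by rewrite -cardS index_mem.
  by have /rowP/(_ (Ordinal im)) := fuv; rewrite !mxE/= nth_index.
Qed.
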